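(* Let $Y$ be a subset of an injective metric space. The following statements are all equivalent: (1) $Y$ is Morse. (2) $Y$ is strongly contracting. (3) There exists an integer $K$ such that every $(9,0)$-quasi-geodesic with endpoints on $Y$ is contained in the $K$-neighborhood of $Y$.
   Context: A metric space $X$ is injective if for any families $\{x_i\}$ in $X$ and $\{r_i\}$ in $[0,\infty)$ with $d(x_i,x_j)\le r_i+r_j$ for all $i\ne j$, the closed balls satisfy $\bigcap_i B(x_i,r_i)\neq\emptyset$. For $\lambda\ge 1,\epsilon\ge 0$, a $(\lambda,\epsilon)$-quasi-geodesic in $X$ is a map $\beta:I\to X$ from an interval $I\subseteq\mathbb{R}$ with $\frac1\lambda|s-t|-\epsilon\le d(\beta(s),\beta(t))\le\lambda|s-t|+\epsilon$ for all $s,t\in I$. $Y$ is Morse if there is $M:\mathbb{R}^+\times\mathbb{R}^+\to\mathbb{R}^+$ (with $\mathbb{R}^+=[0,\infty)$) such that every $(\lambda,\epsilon)$-quasi-geodesic with endpoints on $Y$ is contained in the $M(\lambda,\epsilon)$-neighborhood of $Y$. For $x\in X$ let $\pi_Y(x)=\{y\in Y: d(x,y)\le d(x,Y)+1\}$ and for $B\subseteq X$ let $\pi_Y(B)=\bigcup_{x\in B}\pi_Y(x)$. $Y$ is strongly contracting if there is $D$ such that $\mathrm{diam}(\pi_Y(B))\le D$ for every closed ball $B$ of $X$ disjoint from $Y$. *)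

(* Defs.v *)
From HB Require Import structures.
From mathcomp Require Import all_boot all_order all_algebra.
From mathcomp Require Import all_classical all_reals all_analysis.

Set Implicit Arguments.
Unset Strict Implicit.
Unset Printing Implicit Defensive.

Import Order.TTheory GRing.Theory Num.Theory.

Local Open Scope classical_set_scope.
Local Open Scope ring_scope.

(* This is the closed ball of the metric.  The library's [closed_ball] is the
   closure of the open ball, which in a general metric space can be smaller. *)
Definition metric_cball (R : realType) (X : metricType R) (x : X) (r : R)
  : set X := [set y | mdist x y <= r].

Definition injective_metric_space (R : realType) (X : metricType R) : Prop :=
  forall (I : Type) (x : I -> X) (r : I -> R),
    (forall i, 0 <= r i) ->
    (forall i j, i <> j -> mdist (x i) (x j) <= r i + r j) ->
    \bigcap_i metric_cball (x i) (r i) !=set0.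

(* The value is extended-real, so that the distance to the empty set is +oo. *)
Definition dist_to (R : realType) (X : metricType R) (Y : set X) (x : X)
  : \bar R := ereal_inf [set (mdist x y)%:E | y in Y].

Definition neighborhood_of (R : realType) (X : metricType R) (Y : set X)
  (r : R) : set X := [set x | (dist_to Y x <= r%:E)%E].

(* The value is extended-real: +oo for unbounded sets; the empty set gets -oo,
   hence satisfies every upper bound. *)
Definition diam (R : realType) (X : metricType R) (A : set X) : \bar R :=
  ereal_sup [set (mdist p.1 p.2)%:E | p in A `*` A].

(* A map from the interval I is represented by a function on R, of which only
   the values on I are used. *)
Definition quasi_geodesic (R : realType) (X : metricType R) (lam eps : R)
  (I : set R) (beta : R -> X) : Prop :=
  is_interval I /\
  forall s t, I s -> I t ->
    lam^-1 * `|s - t| - eps <= mdist (beta s) (beta t)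
      <= lam * `|s - t| + eps.

(* A quasi-geodesic has endpoints on Y when its interval of definition is some
   [a, b] and it maps a and b into Y. *)
Definition quasi_geodesics_near (R : realType) (X : metricType R) (Y : set X)
  (lam eps r : R) : Prop :=
  forall (a b : R) (beta : R -> X), a <= b ->
    quasi_geodesic lam eps `[a, b] beta -> Y (beta a) -> Y (beta b) ->
    beta @` `[a, b] `<=` neighborhood_of Y r.

Definition Morse (R : realType) (X : metricType R) (Y : set X) : Prop :=
  exists M : R -> R -> R,
    (forall lam eps, 0 <= lam -> 0 <= eps -> 0 <= M lam eps) /\
    forall lam eps, 1 <= lam -> 0 <= eps ->
      quasi_geodesics_near Y lam eps (M lam eps).

Definition proj_point (R : realType) (X : metricType R) (Y : set X) (x : X)
  : set X := [set y | Y y /\ ((mdist x y)%:E <= dist_to Y x + 1%:E)%E].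

Definition proj_set (R : realType) (X : metricType R) (Y B : set X) : set X :=
  \bigcup_(x in B) proj_point Y x.

Definition strongly_contracting (R : realType) (X : metricType R) (Y : set X)
  : Prop :=
  exists D : R, forall (x : X) (r : R), 0 <= r ->
    metric_cball x r `&` Y = set0 ->
    (diam (proj_set Y (metric_cball x r)) <= D%:E)%E.

(* Main.v *)
Require Import Defs.
From mathcomp Require Import all_boot all_order all_algebra.
From mathcomp Require Import all_classical all_reals all_analysis.
From mathcomp Require Import ring lra.

Set Implicit Arguments.
Unset Strict Implicit.
Unset Printing Implicit Defensive.

Import Order.TTheory GRing.Theory Num.Theory.
Import numFieldNormedType.Exports.

Local Open Scope classical_set_scope.
Local Open Scope ring_scope.

(** Throughout, K is a constant such that (9,0)-quasi-geodesics with endpoints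
    on Y stay in the K-neighborhood of Y, and a projection of x to Y is a point
    of Y whose distance to x is minimal up to 1.

    _Strongly contracting implies Morse_, in every metric space.  Cut a
    quasi-geodesic into steps of parameter length h = lam (D + 1), and let N be
    the bound on the distance moved in one step.  While the path is at distance
    more than N from Y, each step stays in a ball disjoint from Y, so it moves
    the projection by at most D, whereas the quasi-geodesic inequality makes it
    progress by h / lam = D + 1 on average.  Hence an excursion out of the
    N-neighborhood has a bounded number of steps
    ([strongly_contracting_qgeod]).  Morse trivially implies the statement about
    (9,0)-quasi-geodesics.

    _(9,0)-quasi-geodesics near Y imply strongly contracting_, in an injective
    space.  Injectivity is used in two ways: to find points with prescribed
    distances to finitely many given points ([injective_ball_inter4]), and to
    extend partial 1-Lipschitz maps from the real line
    ([lipschitz1_extension]), which produces geodesics and concatenations of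
    paths.

    First, if p is a projection of x and q is in Y, there is a geodesic from p
    to q through a point u which also lies on a geodesic from p to x, at
    distance the Gromov product (x|q)_p from p.  The point u is about that far
    from Y, so the Gromov product is bounded ([gromov_product_bound]):
    d(x,q) is d(x,p) + d(p,q) up to C = 2(K + 1).

    Now let p, q be projections of x, x' with d(x,x') <= d(x,p), and put
    D = d(p,q), T = D - C.  The bound above forces d(x,p) and d(x',q) to be at
    least T.  By injectivity there are u on a geodesic from p to x and v on a
    geodesic from q to x', both at height T, with d(u,v) <= D, although the
    first step shows that points at heights s, s' on the two sides are at
    distance at least T + |s - s'|.  The path p -> u -> v -> q is thus a
    quasi-geodesic up to its two corners.  These are repaired by replacing u, v
    by the points of the two sides which minimize the length of the path from u
    to v along the sides and a connecting geodesic, travel along the sides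
    counting half ([shortcut_exists]); the minimum moves the corners by at most
    2C in total and the path becomes a (9,0)-quasi-geodesic ([rounded_path]).
    Its corners have height at least T - 2C, so T is bounded in terms of K
    ([proj_close]). *)

(** * Projections and neighborhoods without extended reals *)

Section Projections.
Context (R : realType) (X : metricType R) (Y : set X).
Implicit Types (x y p q u : X) (r e D : R).

Lemma dist_to_le x y : Y y -> (dist_to Y x <= (mdist x y)%:E)%E.
Proof.
by move=> Yy; apply: ge_ereal_inf; exists (mdist x y)%:E => //; exists y.
Qed.

Lemma proj_pointP x p :
  proj_point Y x p <->
  Y p /\ forall y, Y y -> mdist x p <= mdist x y + 1.
Proof.
split=> -[Yp xp]; split=> //.
  move=> y Yy; rewrite -lee_fin EFinD; apply: (le_trans xp).
  by rewrite leeD2r// dist_to_le.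
rewrite -leeBlDr// -EFinB; apply/ereal_infP => _ [y Yy <-].
by rewrite lee_fin lerBlDr xp.
Qed.

Lemma neighborhood_of_witness r e x : neighborhood_of Y r x -> 0 < e ->
  exists2 y, Y y & mdist x y < r + e.
Proof.
move=> xr e0; have : (dist_to Y x < (r + e)%:E)%E.
  by apply: (le_lt_trans xr); rewrite lte_fin ltrDl.
by move=> /ereal_inf_lt[_ [y Yy <-]]; rewrite lte_fin; exists y.
Qed.

Lemma far_of_not_neighborhood r x y :
  ~ neighborhood_of Y r x -> Y y -> r < mdist x y.
Proof.
move=> xr Yy; rewrite ltNge; apply/negP => xy; apply: xr.
by apply: (le_trans (dist_to_le _ Yy)); rewrite lee_fin.
Qed.

Lemma proj_point_exists x : Y !=set0 -> exists p, proj_point Y x p.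
Proof.
move=> [y0 Yy0].
have d0 : (0 <= dist_to Y x)%E.
  by apply/ereal_infP => _ [y _ <-]; rewrite lee_fin mdist_ge0.
have dfin : dist_to Y x \is a fin_num.
  by rewrite ge0_fin_numE// (le_lt_trans (dist_to_le x Yy0))// ltry.
have nx : neighborhood_of Y (fine (dist_to Y x)) x.
  by rewrite /neighborhood_of/= fineK.
have [p Yp xp] := neighborhood_of_witness nx ltr01.
by exists p; split=> //; rewrite -(fineK dfin) -EFinD lee_fin ltW.
Qed.

Lemma proj_point_le_neighborhood r x p u :
  proj_point Y x p -> neighborhood_of Y r u ->
  mdist x p <= mdist x u + r + 1.
Proof.
move=> /proj_pointP[_ xp] ur; apply/ler_addgt0Pr => e e0.
have [y Yy uy] := neighborhood_of_witness ur e0.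
by have := xp _ Yy; have := metric_triangle x u y; lra.
Qed.

Definition contracts_by D := forall x x' r p q, 0 <= r ->
  (forall y, Y y -> r < mdist x y) -> mdist x x' <= r ->
  proj_point Y x p -> proj_point Y x' q -> mdist p q <= D.

(** The projection of a ball is controlled by comparing its points with its
    center; this costs a factor 2 in the constant. *)
Lemma strongly_contractingP :
  strongly_contracting Y <-> exists D, contracts_by D.
Proof.
split=> -[D HD].
  exists D => x x' r p q r0 far xx' xp x'q; rewrite -lee_fin.
  have /(HD x r r0) : metric_cball x r `&` Y = set0.
    rewrite -subset0 => y [/= xy /far]; by rewrite ltNge xy.
  apply: le_trans; apply: ereal_sup_ubound; exists (p, q) => //; split=> /=.
    by exists x => //=; rewrite /metric_cball/= mdistxx.
  by exists x'.
exists (D + D) => x r r0 dis.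
have far y : Y y -> r < mdist x y.
  move=> Yy; rewrite ltNge; apply/negP => xy.
  by rewrite -[False]/(set0 y) -dis.
apply: ge_ereal_sup => _ [[p q] [/= [x1 xx1 x1p] [x2 xx2 x2q]] <-].
have [c xc] : exists c, proj_point Y x c.
  by apply: proj_point_exists; exists p; case/proj_pointP: x1p.
rewrite lee_fin; apply: (le_trans (metric_triangle p c q)); apply: lerD.
  by rewrite metric_sym; exact: (HD x x1 r).
exact: (HD x x2 r).
Qed.

End Projections.

(** * Strongly contracting sets are Morse *)

Section StronglyContractingMorse.
Context (R : realType) (X : metricType R) (Y : set X).
(** The last point [f k.+1] may be close to Y: the contraction applies to a step
    as soon as its first endpoint is far. *)
Lemma proj_chain (D N : R) (f : nat -> X) (k : nat) (p q : X) :
  contracts_by Y D -> 0 <= N ->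
  (forall i, (i <= k)%N -> forall y, Y y -> N < mdist (f i) y) ->
  (forall i, mdist (f i) (f i.+1) <= N) ->
  proj_point Y (f 0%N) p -> proj_point Y (f k.+1) q ->
  mdist p q <= k.+1%:R * D.
Proof.
move=> contr N0; elim: k q => [|k IH] q far step f0p fkq.
  by rewrite mul1r; apply: contr N0 (far 0%N _) (step 0%N) f0p fkq.
have [|c fkc] := @proj_point_exists _ _ Y (f k.+1).
  by exists p; case/proj_pointP: f0p.
have pc : mdist p c <= k.+1%:R * D.
  by apply: IH => // i ik; apply: far; exact: leqW.
have cq : mdist c q <= D by apply: contr N0 (far k.+1 _) (step k.+1) fkc fkq.
have := metric_triangle p c q; rewrite -[k.+2%:R]natr1; lra.
Qed.

(** [k.+1] is the first time at which [f] is back in the N-neighborhood of Y. *)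
Lemma first_return (D N : R) (f : nat -> X) (n : nat) (p : X) :
  contracts_by Y D -> 0 <= N ->
  ~ neighborhood_of Y N (f 0%N) -> Y (f n) ->
  (forall i, mdist (f i) (f i.+1) <= N) -> proj_point Y (f 0%N) p ->
  exists k q, [/\ ~ neighborhood_of Y N (f k), Y q,
    mdist (f k.+1) q <= N + 2 & mdist p q <= k.+1%:R * D].
Proof.
move=> contr N0 far0 Yfn step f0p.
have ex : exists i, `[< neighborhood_of Y N (f i) >].
  exists n; apply/asboolP; apply: (le_trans (dist_to_le _ Yfn)).
  by rewrite mdistxx lee_fin.
case: (ex_minnP ex) => -[/asboolP//|k] /asboolP near min.
have far i : (i <= k)%N -> ~ neighborhood_of Y N (f i).
  by move=> ik /asboolP/min; rewrite ltnNge ik.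
have [|q fkq] := @proj_point_exists _ _ Y (f k.+1); first by exists (f n).
exists k, q; split.
- exact: far.
- by case/proj_pointP: fkq.
- have [y Yy fy] := neighborhood_of_witness near ltr01.
  by case/proj_pointP: fkq => _ /(_ _ Yy); lra.
- apply: (proj_chain contr N0 _ step f0p fkq) => i ik y Yy.
  exact: far_of_not_neighborhood (far i ik) Yy.
Qed.

(** From a point outside the N-neighborhood, walk along the path in both
    directions by steps of length h until the N-neighborhood is reached, after
    k1 + 1 and k2 + 1 steps.  The distance between the two exit points is at
    most (k1 + k2 + 2) D + 2 (N + 2) by contraction of projections, and at least
    (k1 + k2) (D + 1) - eps by the quasi-geodesic inequality, which bounds
    k1 + k2. *)
Lemma strongly_contracting_qgeod (D lam eps a b : R) (beta : R -> X) (t : R) :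
  0 <= D -> contracts_by Y D ->
  1 <= lam -> 0 <= eps -> quasi_geodesic lam eps `[a, b] beta ->
  Y (beta a) -> Y (beta b) -> a <= t <= b ->
  let N := lam * (lam * (D + 1)) + eps in
  neighborhood_of Y (N * (2 * D + 2 * N + 6 + eps) + eps + 2) (beta t).
Proof.
move=> D0 contr lam1 eps0 [_ qg] Ya Yb /andP[a_t t_b] N.
set h := lam * (D + 1).
have h0 : 0 < h by apply: mulr_gt0; lra.
have lamh : N = lam * h + eps by [].
have lh0 : 0 < lam * h by apply: mulr_gt0; lra.
have N0 : 0 <= N by lra.
set Q := 2 * D + 2 * N + 4 + eps.
have [near|far] := pselect (neighborhood_of Y N (beta t)).
  apply: (le_trans near); rewrite lee_fin.
  have : N * 6 <= N * (2 * D + 2 * N + 6 + eps) by rewrite ler_wpM2l//; lra.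
  lra.
have upper s s' : a <= s -> s <= s' -> s' <= b ->
    mdist (beta s) (beta s') <= lam * (s' - s) + eps.
  move=> as_ ss' s'b; have [||_] := andP (qg s s' _ _);
    rewrite /= ?in_itv/=; try (apply/andP; split; lra).
  by rewrite distrC ger0_norm//; lra.
have lower s s' : a <= s -> s <= s' -> s' <= b ->
    lam^-1 * (s' - s) - eps <= mdist (beta s) (beta s').
  move=> as_ ss' s'b; have [||+ _] := andP (qg s s' _ _);
    rewrite /= ?in_itv/=; try (apply/andP; split; lra).
  by rewrite distrC ger0_norm//; lra.
have [p tp] := @proj_point_exists _ _ Y (beta t) (ex_intro _ _ Ya).
have [n hn] : exists n : nat, b - a <= n%:R * h.
  exists (Num.bound ((b - a) / h)); rewrite -ler_pdivrMr// ltW//.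
  by rewrite archi_boundP// divr_ge0//; lra.
have iSh i : i.+1%:R * h = i%:R * h + h by rewrite -natr1 mulrDl mul1r.
have ih0 (i : nat) : 0 <= i%:R * h by rewrite mulr_ge0// ltW.
(* The steps are clipped at the endpoints of the path, which lie on Y; the
   clipping is not active before the return to the N-neighborhood. *)
pose tau (i : nat) := Num.min b (t + i%:R * h).
pose sig (i : nat) := Num.max a (t - i%:R * h).
have tauP i : [/\ t <= tau i, tau i <= b, tau i <= t + i%:R * h &
    tau i != b -> tau i = t + i%:R * h].
  rewrite /tau; have ? := ih0 i; case: (leP b (t + i%:R * h)) => ?.
    by split; [lra|lra|lra|rewrite eqxx].
  by split; [lra|lra|lra|].
have sigP i : [/\ sig i <= t, a <= sig i, t - i%:R * h <= sig i &
    sig i != a -> sig i = t - i%:R * h].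
  rewrite /sig; have ? := ih0 i; case: (leP a (t - i%:R * h)) => ?.
    by split; [lra|lra|lra|].
  by split; [lra|lra|lra|rewrite eqxx].
have tau_step i : tau i <= tau i.+1 <= tau i + h.
  rewrite /tau iSh; case: (leP b (t + i%:R * h)) => ?;
  by case: (leP b (t + (i%:R * h + h))) => ?; apply/andP; split; lra.
have sig_step i : sig i - h <= sig i.+1 <= sig i.
  rewrite /sig iSh; case: (leP a (t - i%:R * h)) => ?;
  by case: (leP a (t - (i%:R * h + h))) => ?; apply/andP; split; lra.
have tau0 : tau 0%N = t by rewrite /tau mul0r addr0 min_r.
have sig0 : sig 0%N = t by rewrite /sig mul0r subr0 max_r.
have near_end z : Y z -> neighborhood_of Y N z.
  by move=> Yz; apply: (le_trans (dist_to_le _ Yz)); rewrite mdistxx lee_fin.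
have [||||k1 [q1 [far1 Yq1 xq1 pq1]]] :=
    @first_return D N (beta \o tau) n p contr N0; rewrite /= ?tau0//.
- suff -> : tau n = b by [].
  by rewrite /tau min_l//; lra.
- move=> i; have /andP[ii Sii] := tau_step i.
  have [? ? _ _] := tauP i; have [_ ? _ _] := tauP i.+1.
  have := @upper (tau i) (tau i.+1); rewrite lamh => /(_ _ _ _)/le_trans -> //.
  + lra.
  + by rewrite lerD2r; apply: ler_wpM2l; lra.
have [||||k2 [q2 [far2 Yq2 yq2 pq2]]] :=
    @first_return D N (beta \o sig) n p contr N0; rewrite /= ?sig0//.
- suff -> : sig n = a by [].
  by rewrite /sig max_l//; lra.
- move=> i; have /andP[ii Sii] := sig_step i.
  have [? ? _ _] := sigP i; have [_ ? _ _] := sigP i.+1.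
  rewrite metric_sym.
  have := @upper (sig i.+1) (sig i); rewrite lamh => /(_ _ _ _)/le_trans -> //.
  + lra.
  + by rewrite lerD2r; apply: ler_wpM2l; lra.
move: xq1 yq2 far1 far2; rewrite /= => xq1 yq2 far1 far2.
have tk1 : tau k1 = t + k1%:R * h.
  have [_ _ _] := tauP k1; apply; apply/eqP => E.
  by apply: far1; rewrite E; exact: near_end.
have sk2 : sig k2 = t - k2%:R * h.
  have [_ _ _] := sigP k2; apply; apply/eqP => E.
  by apply: far2; rewrite E; exact: near_end.
have [? tb tle _] := tauP k1.+1; have [? sa _ _] := sigP k2.+1.
have /andP[tS _] := tau_step k1; have /andP[_ sS] := sig_step k2.
have low : (k1%:R + k2%:R) * (D + 1) - eps <=
    mdist (beta (sig k2.+1)) (beta (tau k1.+1)).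
  apply: le_trans (lower _ _ _ _ _) => //; last by lra.
  rewrite lerD2r.
  have -> : (k1%:R + k2%:R) * (D + 1) = lam^-1 * ((k1%:R + k2%:R) * h).
    by rewrite /h; field; lra.
  rewrite ler_wpM2l ?invr_ge0//; lra.
have kQ : k1%:R <= Q.
  have k20 : 0 <= k2%:R :> R by [].
  have T1 := metric_triangle (beta (sig k2.+1)) q2 (beta (tau k1.+1)).
  have T2 := metric_triangle q2 p (beta (tau k1.+1)).
  have T3 := metric_triangle p q1 (beta (tau k1.+1)).
  move: pq1 pq2; rewrite -!natr1 => pq1 pq2.
  rewrite (metric_sym q2 p) (metric_sym q1) in T2 T3.
  rewrite /Q; lra.
have up := upper t (tau k1.+1) a_t ltac:(lra) tb.
apply: (le_trans (dist_to_le _ Yq1)); rewrite lee_fin.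
have T := metric_triangle (beta t) (beta (tau k1.+1)) q1.
have E1 : lam * (tau k1.+1 - t) <= lam * h * (Q + 1).
  rewrite -mulrA ler_wpM2l//; first by lra.
  have : k1%:R * h <= Q * h by rewrite ler_wpM2r// ltW.
  rewrite iSh in tle; lra.
have E2 : lam * h * (Q + 1) <= N * (Q + 1).
  rewrite ler_wpM2r//; last by lra.
  by rewrite /Q; lra.
have -> : 2 * D + 2 * N + 6 + eps = Q + 2 by rewrite /Q; lra.
lra.
Qed.

End StronglyContractingMorse.

Lemma strongly_contracting_Morse (R : realType) (X : metricType R) (Y : set X) :
  strongly_contracting Y -> Morse Y.
Proof.
move=> /strongly_contractingP[D' HD'].
(* A negative constant is possible, for instance when Y is empty. *)
pose D := Num.max D' 0.
have D0 : 0 <= D by rewrite /D le_max lexx orbT.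
have HD : contracts_by Y D.
  by move=> x x' r p q *; rewrite /D le_max (HD' x x' r).
pose N (lam eps : R) := lam * (lam * (D + 1)) + eps.
exists (fun lam eps =>
  N lam eps * (2 * D + 2 * N lam eps + 6 + eps) + eps + 2); split.
  move=> lam eps lam0 eps0.
  have N0 : 0 <= N lam eps by rewrite /N addr_ge0// !mulr_ge0//; lra.
  by rewrite !addr_ge0// mulr_ge0//; lra.
move=> lam eps lam1 eps0 a b beta ab qg Ya Yb _ [t tab <-].
move: tab; rewrite /= in_itv/= => tab.
exact: (strongly_contracting_qgeod D0 HD lam1 eps0 qg Ya Yb tab).
Qed.
(** * Paths in injective spaces *)

Section InjectivePaths.
Context (R : realType) (X : metricType R).

Lemma injective_ball_inter (I : Type) (x : I -> X) (r : I -> R) :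
  injective_metric_space X ->
  (forall i j, mdist (x i) (x j) <= r i + r j) ->
  exists z, forall i, mdist (x i) z <= r i.
Proof.
move=> hX xr; have r0 i : 0 <= r i by have := xr i i; rewrite mdistxx; lra.
have [z zP] := hX I x r r0 (fun i j _ => xr i j).
by exists z => i; exact: zP.
Qed.

Lemma injective_ball_inter4 (x1 x2 x3 x4 : X) (r1 r2 r3 r4 : R) :
  injective_metric_space X ->
  0 <= r1 -> 0 <= r2 -> 0 <= r3 -> 0 <= r4 ->
  mdist x1 x2 <= r1 + r2 -> mdist x1 x3 <= r1 + r3 -> mdist x1 x4 <= r1 + r4 ->
  mdist x2 x3 <= r2 + r3 -> mdist x2 x4 <= r2 + r4 -> mdist x3 x4 <= r3 + r4 ->
  exists z, [/\ mdist x1 z <= r1, mdist x2 z <= r2, mdist x3 z <= r3 &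
                mdist x4 z <= r4].
Proof.
move=> hX h1 h2 h3 h4 h12 h13 h14 h23 h24 h34.
have [[[] []]|z zP] := @injective_ball_inter (bool * bool)%type
  (fun i => if i.1 then if i.2 then x1 else x2 else if i.2 then x3 else x4)
  (fun i => if i.1 then if i.2 then r1 else r2 else if i.2 then r3 else r4) hX.
- by move=> [[] []] //=; rewrite ?mdistxx; lra.
- by move=> [[] []] //=; rewrite 1?metric_sym ?mdistxx; lra.
- by move=> [[] []] //=; rewrite 1?metric_sym ?mdistxx; lra.
- by move=> [[] []] //=; rewrite 1?metric_sym ?mdistxx; lra.
exists z; split.
- exact: (zP (true, true)).
- exact: (zP (true, false)).
- exact: (zP (false, true)).
- exact: (zP (false, false)).
Qed.

Definition lipschitz1 (f : R -> X) :=
  forall s t, s <= t -> mdist (f s) (f t) <= t - s.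

Lemma lipschitz1_norm (f : R -> X) (s t : R) :
  lipschitz1 f -> mdist (f s) (f t) <= `|s - t|.
Proof.
move=> fL; have [st|/ltW ts] := leP s t.
  by rewrite distrC ger0_norm ?fL// subr_ge0.
by rewrite metric_sym ger0_norm ?fL// subr_ge0.
Qed.

(** Partial 1-Lipschitz maps are handled as sets of pairs, so that the union of
    a chain of them is a plain union; any such relation is automatically
    single-valued, since two values at the same time are at distance 0. *)
Definition lipschitz1_graph (G : set (R * X)) :=
  forall g h, G g -> G h -> mdist g.2 h.2 <= `|g.1 - h.1|.

(** A maximal extension exists by Zorn's lemma, and it is total: a value at a
    further time t is a common point of the balls of radius |s - t| centered at
    the values at the times s, which meet because the map is 1-Lipschitz. *)
Lemma lipschitz1_extension (G : set (R * X)) :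
  injective_metric_space X -> lipschitz1_graph G ->
  exists2 f, lipschitz1 f & forall g, G g -> f g.1 = g.2.
Proof.
move=> hX GL; pose P (A : set (R * X)) := lipschitz1_graph (G `|` A).
have [F FP Ftot|A [PA Amax]] := @Zorn_bigcup _ P.
  move=> g h [Gg|[A FA Ag]] [Gh|[B FB Bh]].
  - exact: GL.
  - by apply: (FP _ FB); [left|right].
  - by apply: (FP _ FA); [right|left].
  - have [AB|BA] := Ftot _ _ FA FB.
    + by apply: (FP _ FB); right => //; exact: AB.
    + by apply: (FP _ FA); right => //; exact: BA.
have total t : exists x, A (t, x).
  pose I := {g : R * X | (G `|` A) g}.
  have [|x xP] := @injective_ball_inter I (fun g => (sval g).2)
      (fun g => `|(sval g).1 - t|) hX.
    move=> [g Gg] [h Gh] /=; apply: (le_trans (PA _ _ Gg Gh)).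
    by rewrite (distrC h.1) ler_distD.
  have {}xP g : (G `|` A) g -> mdist g.2 x <= `|g.1 - t|.
    by move=> Gg; exact: (xP (exist _ g Gg)).
  exists x; apply: contrapT => nA; apply: (Amax (A `|` [set (t, x)])).
    split; first exact: subsetUl.
    by move=> /(_ (t, x)) sub; apply: nA; apply: sub; right.
  move=> g h; rewrite setUA => -[Gg|->] [Gh|->] /=.
  - exact: PA.
  - exact: xP.
  - by rewrite metric_sym distrC; exact: xP.
  - by rewrite mdistxx.
have [f fA] := choice total.
exists f => [s t st|g Gg].
  have := PA (s, f s) (t, f t) (or_intror (fA s)) (or_intror (fA t)).
  by rewrite /= distrC ger0_norm// subr_ge0.
apply: mdist_positivity; apply/eqP; rewrite eq_le mdist_ge0 andbT.
have := PA (g.1, f g.1) g (or_intror (fA _)) (or_introl Gg).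
by rewrite /= subrr normr0.
Qed.

(** A 1-Lipschitz path whose endpoints are as far apart as possible has no slack
    in between. *)
Lemma lipschitz1_geodesic (f : R -> X) (a b s t : R) : lipschitz1 f ->
  b - a <= mdist (f a) (f b) -> a <= s -> s <= t -> t <= b ->
  mdist (f s) (f t) = t - s.
Proof.
move=> fL ab as_ st tb; apply/eqP; rewrite eq_le fL//=.
have := metric_triangle (f a) (f s) (f b).
have := metric_triangle (f s) (f t) (f b).
have := fL _ _ as_; have := fL _ _ tb; lra.
Qed.

Lemma geodesic_exists (x y : X) : injective_metric_space X ->
  exists f, [/\ lipschitz1 f, f 0 = x & f (mdist x y) = y].
Proof.
move=> hX.
have [|f fL fE] := @lipschitz1_extension [set (0, x); (mdist x y, y)] hX.
  have d0 := mdist_ge0 x y.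
  move=> g h [->|->] [->|->] /=; rewrite ?mdistxx//.
    by rewrite sub0r normrN ger0_norm.
  by rewrite metric_sym subr0 ger0_norm.
exists f; split=> //; first by apply: (fE (0, x)); left.
by apply: (fE (mdist x y, y)); right.
Qed.

Lemma quasi_geodesic90 (f : R -> X) (a b : R) : lipschitz1 f ->
  (forall s t, a <= s -> s <= t -> t <= b ->
     (t - s) / 9 <= mdist (f s) (f t)) ->
  quasi_geodesic 9 0 `[a, b] f.
Proof.
move=> fL low; split; first exact: interval_is_interval.
have main s t : a <= s -> s <= t -> t <= b ->
    9^-1 * `|s - t| - 0 <= mdist (f s) (f t) <= 9 * `|s - t| + 0.
  move=> as_ st tb; rewrite distrC ger0_norm ?subr_ge0//.
  by have := low _ _ as_ st tb; have := fL _ _ st => *; apply/andP; split; lra.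
move=> s t; rewrite /= !in_itv/= => /andP[as_ sb] /andP[at_ tb].
have [st|ts] := leP s t; first exact: main.
by rewrite distrC metric_sym main// ltW.
Qed.

(** The path follows f from 0 to S, then a geodesic from f S to g T, then g
    backwards.  The corner hypotheses say that leaving the corner f S along f
    decreases the distance to g T at a rate of at most 1/2, and symmetrically.
    So if a point of the first side is at distance a from the corner and a point
    of the middle geodesic at distance b, then their distance is at least
    b - a/2 and at least a - b, hence at least (a + b) / 7. *)
Lemma rounded_path (f g : R -> X) (S T : R) (l := mdist (f S) (g T)) :
  injective_metric_space X ->
  0 <= S -> 0 <= T -> lipschitz1 f -> lipschitz1 g ->
  S <= mdist (f 0) (f S) -> T <= mdist (g 0) (g T) ->
  (forall s, 0 <= s -> s <= S -> l - (S - s) / 2 <= mdist (f s) (g T)) ->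
  (forall t, 0 <= t -> t <= T -> l - (T - t) / 2 <= mdist (f S) (g t)) ->
  (forall s t, 0 <= s -> s <= S -> 0 <= t -> t <= T ->
     ((S - s) + l + (T - t)) / 9 <= mdist (f s) (g t)) ->
  exists c, [/\ quasi_geodesic 9 0 `[0, S + l + T] c,
    c 0 = f 0, c S = f S & c (S + l + T) = g 0].
Proof.
move=> hX S0 T0 fL gL fS gT fcorner gcorner apart.
have l0 : 0 <= l by exact: mdist_ge0.
pose G := [set (s, f s) | s in `[0, S]] `|`
          [set (S + l + T - t, g t) | t in `[0, T]].
have fg s t : s <= S -> t <= T -> mdist (f s) (g t) <= S + l + T - t - s.
  move=> sS tT.
  have := metric_triangle (f s) (f S) (g t).
  have := metric_triangle (f S) (g T) (g t).
  rewrite (metric_sym (g T)) -/l.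
  have := fL _ _ sS; have := gL _ _ tT; lra.
(* Extending the two sides by a 1-Lipschitz map fills in the middle geodesic. *)
have [|c cL cE] := @lipschitz1_extension G hX.
  move=> _ _ [|] [s /= + <-] [|] [t /= + <-] /=; rewrite !in_itv/=.
  - by move=> _ _; exact: lipschitz1_norm.
  - move=> /andP[s0 sS] /andP[t0 tT].
    by rewrite distrC ger0_norm ?fg//; lra.
  - move=> /andP[s0 sS] /andP[t0 tT].
    by rewrite metric_sym ger0_norm ?fg//; lra.
  - move=> _ _; apply: (le_trans (lipschitz1_norm _ _ gL)).
    by rewrite (distrC s) (_ : S + l + T - s - _ = t - s)//; ring.
have cf s : 0 <= s -> s <= S -> c s = f s.
  move=> s0 sS; apply: (cE (s, f s)); left; exists s => //=.
  by rewrite in_itv/= s0.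
have cg t : 0 <= t -> t <= T -> c (S + l + T - t) = g t.
  move=> t0 tT; apply: (cE (S + l + T - t, g t)); right; exists t => //=.
  by rewrite in_itv/= t0.
have cS : c S = f S by exact: cf.
have cT : c (S + l) = g T by rewrite -cg//; congr c; lra.
have cmid : S + l - S <= mdist (c S) (c (S + l)) by rewrite cS cT -/l; lra.
have cgE s : S + l <= s -> s <= S + l + T -> c s = g (S + l + T - s).
  by move=> *; rewrite -cg; [congr c| |]; lra.
have fgeo := @lipschitz1_geodesic f 0 S _ _ fL.
have ggeo := @lipschitz1_geodesic g 0 T _ _ gL.
have mgeo := @lipschitz1_geodesic c S (S + l) _ _ cL cmid.
rewrite !subr0 in fgeo ggeo.
exists c; split => //; first last.
- by rewrite cgE; [congr g|..]; lra.
- exact: cf.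
apply: quasi_geodesic90 => // s t s0 st t1.
have [tS|/ltW St] := leP t S.
  by rewrite !cf//; [rewrite fgeo//; lra|lra..].
have [sS|/ltW Ss] := leP s S.
- rewrite (cf s)//; have [tl|/ltW lt_] := leP t (S + l).
  + have tT : mdist (c t) (g T) = S + l - t by rewrite -cT mgeo.
    have tS : mdist (c t) (f S) = t - S by rewrite -cS metric_sym mgeo.
    have := metric_triangle (f s) (c t) (g T).
    have := metric_triangle (f s) (c t) (f S).
    have := fcorner _ s0 sS; rewrite fgeo// tT tS; lra.
  + rewrite (cgE t)//.
    have := apart s (S + l + T - t) s0 sS; lra.
- have [tl|/ltW lt_] := leP t (S + l).
    by rewrite mgeo//; lra.
  have [ls|/ltW sl] := leP (S + l) s.
    rewrite !cgE//; try lra.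
    by rewrite metric_sym ggeo//; lra.
  rewrite (cgE t)//; set u := S + l + T - t.
  have u0 : 0 <= u by rewrite /u; lra.
  have uT : u <= T by rewrite /u; lra.
  have sT : mdist (c s) (g T) = S + l - s by rewrite -cT mgeo.
  have sS : mdist (c s) (f S) = s - S by rewrite -cS metric_sym mgeo.
  have := metric_triangle (g u) (c s) (f S).
  have := metric_triangle (g u) (c s) (g T).
  have := gcorner _ u0 uT.
  rewrite ggeo// sT sS (metric_sym (f S)) (metric_sym (c s)) /u; lra.
Qed.

(** Up to a constant, the minimized function is the length of a path from f T to
    g T that follows f back to f s, jumps to g t and follows g to g T, where the
    parts on f and g count half. *)
Lemma shortcut_exists (f g : R -> X) (T : R) : 0 <= T ->
  lipschitz1 f -> lipschitz1 g ->
  exists s t, [/\ 0 <= s <= T, 0 <= t <= T &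
    forall s' t', 0 <= s' <= T -> 0 <= t' <= T ->
      mdist (f s) (g t) - (s + t) / 2 <= mdist (f s') (g t') - (s' + t') / 2].
Proof.
move=> T0 fL gL.
pose F (z : R * R) := mdist (f z.1) (g z.2) - (z.1 + z.2) / 2.
have Flip z w : F z - F w <= 2 * `|z.1 - w.1| + 2 * `|z.2 - w.2|.
  have := metric_triangle (f z.1) (f w.1) (g z.2).
  have := metric_triangle (f w.1) (g w.2) (g z.2).
  have := lipschitz1_norm z.1 w.1 fL; have := lipschitz1_norm z.2 w.2 gL.
  rewrite (metric_sym (g w.2)) /F.
  have := ler_norm (w.1 - z.1); have := ler_norm (w.2 - z.2).
  rewrite !(distrC (w.1)) !(distrC (w.2)).
  have := normr_ge0 (z.1 - w.1); have := normr_ge0 (z.2 - w.2); lra.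
have Fc : continuous F.
  move=> z; apply/cvgrPdist_lt => e e0.
  have e40 : 0 < e / 4 by lra.
  have n1 : \forall w \near z, `|z.1 - w.1| < e / 4.
    have /cvgrPdist_lt : w.1 @[w --> z] --> z.1 by exact: cvg_fst.
    exact.
  have n2 : \forall w \near z, `|z.2 - w.2| < e / 4.
    have /cvgrPdist_lt : w.2 @[w --> z] --> z.2 by exact: cvg_snd.
    exact.
  near=> w.
  have w1 : `|z.1 - w.1| < e / 4 by near: w.
  have w2 : `|z.2 - w.2| < e / 4 by near: w.
  have := Flip z w; have := Flip w z.
  rewrite !(distrC (w.1)) !(distrC (w.2)) => *.
  by rewrite ltr_norml; apply/andP; split; lra.
have [|||[s t] + Fmin] :=
  @compact_EVT_min (R * R)%type R F (`[0, T] `*` `[0, T]).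
- by exists (0, 0); split; rewrite /= in_itv/= lexx.
- by apply: compact_setX; exact: segment_compact.
- exact: continuous_subspaceT.
rewrite inE /= !in_itv/= => -[sT tT]; exists s, t; split=> // s' t' s'T t'T.
by apply: (Fmin (s', t')); rewrite inE /= !in_itv.
Unshelve. all: by end_near.
Qed.

End InjectivePaths.

(** * Sets close to (9,0)-quasi-geodesics are strongly contracting *)

Section MorseGauge.
Context (R : realType) (X : metricType R) (Y : set X) (K : R).
Implicit Types (x y p q u : X).

(** The bounded quantity is twice the Gromov product t = (x|q)_p.  By injectivity
    there is u with d(p,u) = t, d(x,u) = d(x,p) - t and d(q,u) = d(p,q) - t.  It
    lies on a geodesic from p to q, hence in the K-neighborhood of Y, but p is a
    projection of u up to 1, so t <= K + 1. *)
Lemma gromov_product_bound x p q : injective_metric_space X ->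
  quasi_geodesics_near Y 9 0 K -> proj_point Y x p -> Y q ->
  0 <= mdist x p + mdist p q - mdist x q <= 2 * (K + 1).
Proof.
move=> hX near xp Yq; have Yp : Y p by case/proj_pointP: xp.
have pq := metric_triangle x p q; apply/andP; split; first lra.
set H := mdist x p in pq *; set D := mdist p q in pq *.
pose t := (H + D - mdist x q) / 2.
have xq_p := metric_triangle x q p; have px_q := metric_triangle p x q.
rewrite (metric_sym q) (metric_sym p x) -/H -/D in xq_p px_q.
have [t0 tH tD] : [/\ 0 <= t, t <= H & t <= D] by rewrite /t; split; lra.
have [||||||||||u [pu xu qu _]] :=
  @injective_ball_inter4 _ _ p x q q t (H - t) (D - t) (D - t) hX;
  rewrite ?mdistxx -/D 1?(metric_sym p x) -/H; rewrite /t; try lra.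
have D0 : 0 <= D by exact: mdist_ge0.
have [|c cL cE] := @lipschitz1_extension _ _ [set (0, p); (t, u); (D, q)] hX.
  have pu' := metric_triangle p u q.
  rewrite (metric_sym u) -/D in pu'.
  move=> g h [[->|->]|->] [[->|->]|->] /=; rewrite ?mdistxx//.
  - by rewrite sub0r normrN ger0_norm//.
  - by rewrite sub0r normrN ger0_norm//.
  - by rewrite subr0 metric_sym ger0_norm.
  - by rewrite distrC ger0_norm ?subr_ge0// metric_sym.
  - by rewrite subr0 metric_sym ger0_norm.
  - by rewrite ger0_norm ?subr_ge0.
have c0 : c 0 = p by apply: (cE (0, p)); left; left.
have ct : c t = u by apply: (cE (t, u)); left; right.
have cD : c D = q by apply: (cE (D, q)); right.
have cqg : quasi_geodesic 9 0 `[0, D] c.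
  apply: quasi_geodesic90 => // s s' s0 ss' s'D.
  rewrite (@lipschitz1_geodesic _ _ c 0 D)//; first lra.
  by rewrite c0 cD subr0.
have uK : neighborhood_of Y K u.
  apply: (near 0 D c) => //; rewrite ?c0 ?cD//.
  by exists t => //=; rewrite in_itv/= t0.
have := proj_point_le_neighborhood xp uK; rewrite -/H -/D /t in t0 xu *; lra.
Qed.

Lemma proj_on_geodesic x p u : mdist x u + mdist u p = mdist x p ->
  proj_point Y x p -> proj_point Y u p.
Proof.
move=> xup /proj_pointP[Yp xp]; apply/proj_pointP; split=> // y Yy.
by have := xp _ Yy; have := metric_triangle x u y; lra.
Qed.

(** The hypothesis on d(x,x') is where the ball disjoint from Y enters: together
    with the bounds on Gromov products it forces both x and x' to be at distance
    at least T = d(p,q) - 2(K + 1) from their projections. *)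
Lemma proj_close x x' p q : injective_metric_space X ->
  quasi_geodesics_near Y 9 0 K -> proj_point Y x p -> proj_point Y x' q ->
  mdist x x' <= mdist x p -> mdist p q <= 8 * (K + 1).
Proof.
move=> hX near xp x'q.
have Yp : Y p by case/proj_pointP: xp.
have Yq : Y q by case/proj_pointP: x'q.
have /andP[xpq xpqC] := gromov_product_bound hX near xp Yq.
have /andP[x'qp x'qpC] := gromov_product_bound hX near x'q Yp.
rewrite (metric_sym q p) in x'qp x'qpC.
set H := mdist x p in xpq xpqC *; set H' := mdist x' q in x'qp x'qpC.
set D := mdist p q in xpq xpqC x'qp x'qpC *.
set C := 2 * (K + 1) in xpqC x'qpC.
move=> xx'H.
have C0 : 0 <= C by lra.
have [Dle|ltD] := leP D (2 * C); first by rewrite /C in Dle C0; lra.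
have tri1 := metric_triangle x x' q; have tri2 := metric_triangle x' x p.
rewrite -/H -/H' (metric_sym x' x) in tri1 tri2.
have tri3 := metric_triangle p q x'.
rewrite (metric_sym p x') (metric_sym q x') -/D -/H' in tri3.
have [T TE] : exists T, T = D - C by exists (D - C).
have T0 : 0 < T by lra.
have TH : T <= H by lra.
have TH' : T <= H' by lra.
(* The radii around q and x' are the largest values that d(q,u) and d(x',u) may
   take and still leave room for a point v at distance D from u. *)
have [||||||||||u [pu xu qu x'u]] :=
  @injective_ball_inter4 _ _ p x q x' T (H - T) (D + T) (H' + D - T) hX;
  rewrite ?(metric_sym p x) ?(metric_sym p x') ?(metric_sym q x') -/H -/H' -/D;
  try lra.
have [||||||||||v [qv x'v uv _]] :=
  @injective_ball_inter4 _ _ q x' u u T (H' - T) D D hX;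
  rewrite ?(metric_sym q x') ?mdistxx -/H'; try lra.
have puT : mdist p u = T.
  by have := metric_triangle x u p; rewrite (metric_sym u p) -/H; lra.
have qvT : mdist q v = T.
  by have := metric_triangle x' v q; rewrite (metric_sym v q) -/H'; lra.
have [f [fL f0 fT]] := geodesic_exists p u hX.
have [g [gL g0 gT]] := geodesic_exists q v hX.
rewrite puT in fT; rewrite qvT in gT.
have fgeo s s' : 0 <= s -> s <= s' -> s' <= T -> mdist (f s) (f s') = s' - s.
  by apply: lipschitz1_geodesic => //; rewrite f0 fT puT subr0.
have ggeo s s' : 0 <= s -> s <= s' -> s' <= T -> mdist (g s) (g s') = s' - s.
  by apply: lipschitz1_geodesic => //; rewrite g0 gT qvT subr0.
have fp s : 0 <= s -> s <= T -> mdist x (f s) = H - s /\ proj_point Y (f s) p.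
  move=> s0 sT; have ps := fgeo _ _ (lexx 0) s0 sT; rewrite f0 subr0 in ps.
  have su := fgeo _ _ s0 sT (lexx T); rewrite fT in su.
  have t1 := metric_triangle x (f s) p; have t2 := metric_triangle x u (f s).
  rewrite (metric_sym u) in t2; rewrite (metric_sym (f s) p) -/H in t1.
  have xs : mdist x (f s) = H - s by lra.
  split=> //; apply: (proj_on_geodesic _ xp).
  by rewrite (metric_sym (f s) p) -/H; lra.
have gq s : 0 <= s -> s <= T -> proj_point Y (g s) q.
  move=> s0 sT; have ps := ggeo _ _ (lexx 0) s0 sT; rewrite g0 subr0 in ps.
  have su := ggeo _ _ s0 sT (lexx T); rewrite gT in su.
  have t1 := metric_triangle x' (g s) q; have t2 := metric_triangle x' v (g s).
  rewrite (metric_sym v) in t2; rewrite (metric_sym (g s) q) -/H' in t1.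
  by apply: (proj_on_geodesic _ x'q); rewrite (metric_sym (g s) q) -/H'; lra.
have apart s s' : 0 <= s -> s <= T -> 0 <= s' -> s' <= T ->
    T + `|s - s'| <= mdist (f s) (g s').
  move=> s0 sT s'0 s'T.
  have [_ fsp] := fp _ s0 sT; have gsq := gq _ s'0 s'T.
  have /andP[_ b1] := gromov_product_bound hX near fsp Yq.
  have /andP[_ b2] := gromov_product_bound hX near gsq Yp.
  have ps := fgeo _ _ (lexx 0) s0 sT; rewrite f0 subr0 in ps.
  have qs := ggeo _ _ (lexx 0) s'0 s'T; rewrite g0 subr0 in qs.
  have t1 := metric_triangle (f s) (g s') q.
  have t2 := metric_triangle (g s') (f s) p.
  rewrite !(metric_sym _ p) !(metric_sym _ q) (metric_sym (g s')) in b1 b2 t1 t2.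
  rewrite (metric_sym q p) -/D -/C in b1 b2.
  rewrite -lerBrDl ler_norml; apply/andP; split; lra.
have [S [S' [/andP[S0 ST] /andP[S'0 S'T] Smin]]] :=
  shortcut_exists (ltW T0) fL gL.
have {}Smin s s' : 0 <= s -> s <= T -> 0 <= s' -> s' <= T ->
    mdist (f S) (g S') - (S + S') / 2 <= mdist (f s) (g s') - (s + s') / 2.
  by move=> s0 sT s'0 s'T; apply: Smin; apply/andP.
(* Compare the minimum with the value at the tops u, v of the two sides: there
   the distance is at most D = T + C, and nowhere is it less than T. *)
have SC : T - 2 * C <= S.
  have := Smin T T (ltW T0) (lexx _) (ltW T0) (lexx _); rewrite fT gT.
  have := apart S S' S0 ST S'0 S'T; have := normr_ge0 (S - S').
  lra.
have [|||||c [cqg c0 cS c1]] := @rounded_path _ _ f g S S' hX S0 S'0 fL gL.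
- by rewrite fgeo ?subr0.
- by rewrite ggeo ?subr0.
- by move=> s s0 sS; have := Smin s S' s0 (le_trans sS ST) S'0 S'T; lra.
- by move=> s s0 sS; have := Smin S s S0 ST s0 (le_trans sS S'T); lra.
- move=> s s' s0 sS s'0 s'S'.
  have := apart s s' s0 (le_trans sS ST) s'0 (le_trans s'S' S'T).
  have := Smin T T (ltW T0) (lexx _) (ltW T0) (lexx _); rewrite fT gT.
  have := normr_ge0 (s - s'); lra.
have nfS : neighborhood_of Y K (f S).
  rewrite -cS; apply: (near 0 (S + mdist (f S) (g S') + S') c) => //.
  - by rewrite !addr_ge0 ?mdist_ge0.
  - by rewrite c0 f0.
  - by rewrite c1 g0.
  - exists S => //=; rewrite in_itv/= S0 /=.
    by have := mdist_ge0 (f S) (g S'); lra.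
have := proj_point_le_neighborhood xp nfS.
have [-> _] := fp _ S0 ST; rewrite -/H => HK.
rewrite /C in TE SC *; lra.
Qed.

Lemma near_strongly_contracting : injective_metric_space X ->
  quasi_geodesics_near Y 9 0 K -> strongly_contracting Y.
Proof.
move=> hX near; apply/strongly_contractingP.
exists (8 * (K + 1)) => x x' r p q r0 far xx' xp x'q.
apply: (proj_close hX near xp x'q); apply: (le_trans xx').
by apply/ltW/far; case/proj_pointP: xp.
Qed.

End MorseGauge.

Theorem corollary3p5 (R : realType) (X : metricType R) (Y : set X)
    (hX : injective_metric_space X) :
  [<-> Morse Y;
       strongly_contracting Y;
       exists K : int, quasi_geodesics_near Y 9 0 K%:~R].
Proof.
have Morse_near : Morse Y -> exists K : int, quasi_geodesics_near Y 9 0 K%:~R.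
  move=> [M [_ HM]].
  have l1 : 1 <= 9 :> R by lra.
  exists (Num.ceil (M 9 0)) => a b c ab cqg ca cb z.
  move=> /(HM 9 0 l1 (lexx 0) a b c ab cqg ca cb).
  by move=> /le_trans; apply; rewrite lee_fin ceil_ge.
have near_contr : (exists K : int, quasi_geodesics_near Y 9 0 K%:~R) ->
    strongly_contracting Y.
  by move=> [K near]; exact: near_strongly_contracting hX near.
tfae.
- by move=> /Morse_near/near_contr.
- by move=> /strongly_contracting_Morse/Morse_near.
- by move=> /near_contr/strongly_contracting_Morse.
Qed.
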